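(* Let $A=[A_{ij}]_{i,j=1,2}$ and $B=[B_{ij}]_{i,j=1,2}$ in $M_n(\mathbb{F})$ be self-adjoint ($A^*=A$, $B^*=B$), partitioned conformally into $2\times 2$ block matrices with $A_{ij},B_{ij}\in M_{n_i\times n_j}(\mathbb{F})$, $n=n_1+n_2$. If $A\leq B$, then the following statements are equivalent: (a) $J\operatorname{ppt}(A)\leq J\operatorname{ppt}(B)$; (b) $(B_{22})^+\leq (A_{22})^+$; (c) $\operatorname{rank}[(1-t)A_{22}+tB_{22}]$ is constant for all $t\in[0,1]$. Moreover, if any of these statements is true, then $A/A_{22}\leq B/B_{22}$.
   Context: $\mathbb{F}=\mathbb{R}$ or $\mathbb{F}=\mathbb{C}$; $M_{p\times q}(\mathbb{F})$ is the set of $p\times q$ matrices over $\mathbb{F}$ and $M_p(\mathbb{F})=M_{p\times p}(\mathbb{F})$. $X^*$ is the (conjugate) transpose and $X^+$ the Moore-Penrose pseudoinverse of $X$. For self-adjoint $X,Y$, $X\leq Y$ (Löwner order) means $Y-X$ is positive semi-definite. For $A=\begin{bmatrix} A_{11} & A_{12} \\ A_{21} & A_{22} \end{bmatrix}\in M_n(\mathbb{F})$ with $A_{ij}\in M_{n_i\times n_j}(\mathbb{F})$, $n=n_1+n_2$, the (generalized) Schur complement is $A/A_{22}=A_{11}-A_{12}A_{22}^+A_{21}\in M_{n_1}(\mathbb{F})$, the (generalized) principal pivot transform is $\operatorname{ppt}(A)=\begin{bmatrix} A/A_{22} & A_{12}A_{22}^+ \\ -A_{22}^+A_{21} & A_{22}^+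 \end{bmatrix}$, and $J=\begin{bmatrix} I_{n_1} & 0 \\ 0 & -I_{n_2} \end{bmatrix}$, so that $J\operatorname{ppt}(A)=\begin{bmatrix} A/A_{22} & A_{12}A_{22}^+ \\ A_{22}^+A_{21} & -A_{22}^+ \end{bmatrix}$. *)

(* Defs.v *)
From HB Require Import structures.
From mathcomp Require Import all_boot all_order all_algebra.
From mathcomp Require Import complex.
From mathcomp Require Import boolp classical_sets reals.

Set Implicit Arguments.
Unset Strict Implicit.
Unset Printing Implicit Defensive.

Import Order.TTheory GRing.Theory Num.Theory.
Local Open Scope ring_scope.
Local Open Scope complex_scope.

Variant RCkind := RealKind | ComplexKind.

(* The order of [R[i]] is the partial one for which [0 <= z] means that [z] is
   real and nonnegative. *)
Definition RCfield (R : realType) (k : RCkind) : numFieldType :=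
  match k with
  | RealKind => R
  | ComplexKind => R[i]
  end.

Definition RCconj (R : realType) (k : RCkind) :
    {rmorphism RCfield R k -> RCfield R k} :=
  match k with
  | RealKind => idfun
  | ComplexKind => @conjc R
  end.
Arguments RCconj {R k}.

Lemma RCconjK (R : realType) (k : RCkind) : involutive (@RCconj R k).
Proof. by case: k => //; exact: conjcK. Qed.

Lemma RCconj_normK (R : realType) (k : RCkind) (x : RCfield R k) :
  RCconj x * x = `|x| ^+ 2.
Proof.
case: k x => x; first by rewrite -normrX ger0_norm ?sqr_ge0 // expr2.
by rewrite mulrC [RHS]sqr_normc.
Qed.

Section Matrices.
Context {R : realType} {k : RCkind}.
Local Notation F := (RCfield R k).

Definition adjmx m n (X : 'M[F]_(m, n)) : 'M[F]_(n, m) := (map_mx RCconj X)^T.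

Definition selfadjoint n (X : 'M[F]_n) : Prop := adjmx X = X.

Definition psdmx n (X : 'M[F]_n) : Prop :=
  selfadjoint X /\ forall v : 'cV[F]_n, 0 <= (adjmx v *m X *m v) 0 0.

Definition loewner n (X Y : 'M[F]_n) : Prop := psdmx (Y - X).

Definition penrose m n (X : 'M[F]_(m, n)) (Y : 'M[F]_(n, m)) : Prop :=
  [/\ X *m Y *m X = X, Y *m X *m Y = Y,
      selfadjoint (X *m Y) & selfadjoint (Y *m X)].

(* The default value [0] is never taken: see [mpinvP]. *)
Definition mpinv m n (X : 'M[F]_(m, n)) : 'M[F]_(n, m) :=
  xget 0 [set Y | penrose X Y].

Lemma adjmxK m n (X : 'M[F]_(m, n)) : adjmx (adjmx X) = X.
Proof. by apply/matrixP => i j; rewrite !mxE RCconjK. Qed.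

Lemma adjmxM m n p (X : 'M[F]_(m, n)) (Y : 'M[F]_(n, p)) :
  adjmx (X *m Y) = adjmx Y *m adjmx X.
Proof. by rewrite /adjmx map_mxM trmx_mul. Qed.

Lemma adjmx1 n : adjmx (1%:M : 'M[F]_n) = 1%:M.
Proof. by rewrite /adjmx map_mx1 trmx1. Qed.

Lemma adjmx_mul_eq0 m n (X : 'M[F]_(m, n)) : adjmx X *m X = 0 -> X = 0.
Proof.
move=> XX0; apply/matrixP => i j; rewrite mxE.
have /eqP := congr1 (fun M : 'M[F]_n => M j j) XX0; rewrite !mxE.
under eq_bigr => l _ do rewrite !mxE RCconj_normK.
rewrite psumr_eq0 => [/allP /(_ i)|l _]; last exact: exprn_ge0.
by rewrite mem_index_enum => /(_ isT); rewrite sqrf_eq0 normr_eq0 => /eqP.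
Qed.

Lemma gram_unit m n (X : 'M[F]_(m, n)) :
  row_free X -> X *m adjmx X \in unitmx.
Proof.
move=> Xfree; rewrite -row_free_unit -kermx_eq0; set K := kermx _.
apply/eqP; apply: (row_free_inj Xfree); rewrite mul0mx.
suff KX0 : adjmx (K *m X) = 0.
  by rewrite -[LHS]adjmxK KX0 /adjmx map_mx0 trmx0.
apply: adjmx_mul_eq0; rewrite adjmxK adjmxM !mulmxA -(mulmxA K).
by rewrite mulmx_ker mul0mx.
Qed.

Lemma adjmx_inv n (X : 'M[F]_n) : adjmx (invmx X) = invmx (adjmx X).
Proof. by rewrite /adjmx map_invmx trmx_inv. Qed.

Lemma penrose_exists m n (X : 'M[F]_(m, n)) : exists Y, penrose X Y.
Proof.
have [r [C [D [XE uC uD]]]] : exists r (C : 'M[F]_(m, r)) (D : 'M[F]_(r, n)),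
    [/\ X = C *m D, adjmx C *m C \in unitmx & D *m adjmx D \in unitmx].
  exists (\rank X), (col_base X), (row_base X); split.
  - by rewrite mulmx_base.
  - rewrite -{2}[col_base X]adjmxK; apply: gram_unit.
    by rewrite /adjmx /row_free mxrank_tr mxrank_map -/(row_full _) col_base_full.
  - exact/gram_unit/row_base_free.
exists (adjmx D *m invmx (D *m adjmx D) *m invmx (adjmx C *m C) *m adjmx C).
set P := invmx (D *m _); set Q := invmx (_ *m C).
have XY : X *m (adjmx D *m P *m Q *m adjmx C) = C *m Q *m adjmx C.
  by rewrite XE !mulmxA -(mulmxA C D) -(mulmxA C _ P) mulmxV // mulmx1.
have YX : (adjmx D *m P *m Q *m adjmx C) *m X = adjmx D *m P *m D.
  rewrite XE !mulmxA -(mulmxA _ (adjmx C) C) -(mulmxA _ Q) mulVmx //.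
  by rewrite mulmx1.
have aP : adjmx P = P by rewrite adjmx_inv adjmxM adjmxK.
have aQ : adjmx Q = Q by rewrite adjmx_inv adjmxM adjmxK.
split; rewrite /selfadjoint ?XY ?YX.
- rewrite {1}XE !mulmxA -(mulmxA _ (adjmx C) C) -(mulmxA _ Q) mulVmx //.
  by rewrite mulmx1 -XE.
- rewrite !mulmxA -(mulmxA _ D (adjmx D)) -(mulmxA _ P (D *m _)) mulVmx //.
  by rewrite mulmx1.
- by rewrite !adjmxM adjmxK aQ mulmxA.
- by rewrite !adjmxM adjmxK aP mulmxA.
Qed.

Lemma penrose_unique m n (X : 'M[F]_(m, n)) (Y Z : 'M[F]_(n, m)) :
  penrose X Y -> penrose X Z -> Y = Z.
Proof.
case=> XYX YXY aXY aYX [XZX ZXZ aXZ aZX].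
have E1 : X *m Y = X *m Z.
  by rewrite -aXY -{1}XZX -mulmxA adjmxM aXY aXZ !mulmxA XYX.
have E2 : Y *m X = Z *m X.
  by rewrite -aYX -{1}XZX -(mulmxA X) mulmxA adjmxM aYX aZX -mulmxA
             (mulmxA X) XYX.
by rewrite -YXY E2 -mulmxA E1 mulmxA ZXZ.
Qed.

Lemma mpinvP m n (X : 'M[F]_(m, n)) : penrose X (mpinv X).
Proof. by have [Y XY] := penrose_exists X; exact: (xgetI 0 XY). Qed.

Section Blocks.
Variables n1 n2 : nat.
Implicit Type A : 'M[F]_(n1 + n2).

(* The blocks [A_11], [A_12], [A_21], [A_22] of [A] are [ulsubmx A],
   [ursubmx A], [dlsubmx A], [drsubmx A]. *)
Definition schur_compl A : 'M[F]_n1 :=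
  ulsubmx A - ursubmx A *m mpinv (drsubmx A) *m dlsubmx A.

Definition ppt A : 'M[F]_(n1 + n2) :=
  block_mx (schur_compl A) (ursubmx A *m mpinv (drsubmx A))
           (- (mpinv (drsubmx A) *m dlsubmx A)) (mpinv (drsubmx A)).

Definition signmx : 'M[F]_(n1 + n2) := block_mx 1%:M 0 0 (- 1%:M).

End Blocks.
End Matrices.
Arguments signmx {R k n1 n2}.

(* Main.v *)
Require Import Defs.
From mathcomp Require Import all_boot all_order all_algebra.
From mathcomp Require Import complex reals.
From mathcomp Require Import boolp classical_sets.
From mathcomp Require Import ring.

(* Write [D0 <= D1] for the two (2,2) blocks, [G0] and [G1] for their
   pseudoinverses and [E = D1 - D0].

   Constancy of the rank along [D0 + t E] forces [ker D0] to lie in [ker E], and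
   it keeps the kernel of [E + t E G0 E] equal to [ker E] for all [t] in [0, 1];
   an affine pencil that starts positive semi-definite and has constant kernel
   stays so, whence [X = E + E G0 E] is positive semi-definite.  Then
   [G0 - G1 = G1 X G1] gives (b), and, with [L = (B12 - A12) E^+],
     [J ppt B - J ppt A = V^* X V + diag (B11 - A11 - L E L^*, 0)],
     [V = (G1 B21 - L^*, - G1)],
   gives (a), the last term being the Schur complement of [B - A].  The diagonal
   blocks of (a) are (b) and the inequality of Schur complements.

   Conversely (b) forces [ker D0 = ker D1] by a dimension count, and if
   [(D0 + t E) v = 0] then [w = E v] satisfies
   [t (1 - t) w^* (G0 - G1) w = - v^* E v], so that [E v = 0]. *)

Set Implicit Arguments.
Unset Strict Implicit.
Unset Printing Implicit Defensive.

Import Order.TTheory GRing.Theory Num.Theory.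
Local Open Scope ring_scope.

(** * Induction along the unit interval *)

(** Some point of [T] lies within [e] of [sup T], and the step carries [S] from it to
    [Num.min 1 (sup T + e / 2)]. This cannot exceed [sup T], so the minimum is 1. Crossing [s] from
    left to right merges the closed and the open half of a connectedness argument. *)
Lemma unit_interval_ind (R : realType) (S : R -> Prop) :
  S 0 ->
  (forall s, 0 <= s <= 1 -> exists2 e, 0 < e &
     forall t u, 0 <= t <= s -> s <= u <= 1 -> s - e < t -> u < s + e ->
       S t -> S u) ->
  S 1.
Proof.
move=> S0 Sstep; pose T := [set t : R | 0 <= t <= 1 /\ S t]%classic.
have T0 : T 0 by split=> //; rewrite lexx ler01.
have T1 : ubound T 1 by move=> t [/andP[]].
have supT : has_sup T by split; [exists 0 | exists 1].
have [s0 s1] : 0 <= sup T /\ sup T <= 1.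
  by split; [exact: (sup_upper_bound supT) | apply: ge_sup => //; exists 0].
have [|e e0 He] := Sstep (sup T); first exact/andP.
have [t Tt tT] := sup_adherent e0 supT.
have tle : t <= sup T by exact: sup_upper_bound.
case: (Tt) => /andP[t0 _] St.
have ltu : Num.min 1 (sup T + e / 2) < sup T + e.
  by rewrite gt_min orbC ltrD2l ltr_pdivrMr // ltr_pMr // ltr1n.
have leu : sup T <= Num.min 1 (sup T + e / 2).
  by rewrite le_min s1 lerDl divr_ge0 // ltW.
have Su : S (Num.min 1 (sup T + e / 2)).
  by apply: (He t) => //; rewrite ?t0 ?leu ?ge_min ?lexx.
have : Num.min 1 (sup T + e / 2) <= sup T.
  apply: sup_upper_bound => //; split=> //.
  by rewrite (le_trans s0 leu) ge_min lexx.
move: Su; case: (leP 1 (sup T + e / 2)) => // _ _.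
by rewrite gerDl leNgt divr_gt0.
Qed.

(** * Real elements of the scalar field *)

Section RCfieldTheory.
Context {R : realType} {k : RCkind}.
Local Notation F := (RCfield R k).

Lemma RCconj_real (x : F) : 0 <= x -> RCconj x = x.
Proof.
case: k x => //= -[a b]; rewrite lecE /= => /andP[/eqP -> _].
by rewrite oppr0.
Qed.

Lemma RCreal_conj (x : F) : RCconj x = x -> x \is Num.real.
Proof.
case: k x => [x _|[a b] [/eqP]]; first exact: num_real.
by rewrite complex_real eq_sym -addr_eq0 -mulr2n mulrn_eq0.
Qed.

(** In the complex case the order makes [e] and every point between 0 and 1 real, so the real
    induction applies along the embedding of [R]. *)
Lemma RC_unit_interval_ind (S : F -> Prop) :
  S 0 ->
  (forall s, 0 <= s <= 1 -> exists2 e, 0 < e &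
     forall t u, 0 <= t <= s -> s <= u <= 1 -> s - t < e -> u - s < e ->
       S t -> S u) ->
  S 1.
Proof.
case: k S => /= S S0 Sstep.
  apply: unit_interval_ind => // s /Sstep[e e0 He]; exists e => // t u *.
  by apply: (He t) => //; [rewrite ltrBlDr -ltrBlDl | rewrite ltrBlDl].
apply: (@unit_interval_ind _ (fun s => S s%:C%C)) => // s s01.
have [|e e0 He] := Sstep s%:C%C; first by rewrite !lecE /= !eqxx.
have eR : (complex.Re e)%:C%C = e by rewrite RRe_real ?gtr0_real.
exists (complex.Re e) => [|t u ts us tse use]; first by rewrite -ltcR eR.
apply: He; rewrite ?lecE /= ?eqxx //.
  by rewrite -rmorphB -eR ltcR ltrBlDr -ltrBlDl.
by rewrite -rmorphB -eR ltcR ltrBlDl.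
Qed.

End RCfieldTheory.

(** * Adjoints, pseudoinverses and row spaces *)

Section Adjoint.
Context {R : realType} {k : RCkind}.
Local Notation F := (RCfield R k).

Lemma adjmx0 m n : adjmx (0 : 'M[F]_(m, n)) = 0.
Proof. by rewrite /adjmx map_mx0 trmx0. Qed.

Lemma adjmxD m n (X Y : 'M[F]_(m, n)) : adjmx (X + Y) = adjmx X + adjmx Y.
Proof. by rewrite /adjmx map_mxD linearD. Qed.

Lemma adjmxN m n (X : 'M[F]_(m, n)) : adjmx (- X) = - adjmx X.
Proof. by rewrite /adjmx map_mxN linearN. Qed.

Lemma adjmxB m n (X Y : 'M[F]_(m, n)) : adjmx (X - Y) = adjmx X - adjmx Y.
Proof. by rewrite adjmxD adjmxN. Qed.

Lemma adjmxZ m n a (X : 'M[F]_(m, n)) :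
  adjmx (a *: X) = RCconj a *: adjmx X.
Proof. by apply/matrixP => i j; rewrite !mxE rmorphM. Qed.

Lemma adjmx_block m1 m2 n1 n2 (A : 'M[F]_(m1, n1)) (B : 'M[F]_(m1, n2))
    (C : 'M[F]_(m2, n1)) (D : 'M[F]_(m2, n2)) :
  adjmx (block_mx A B C D) =
  block_mx (adjmx A) (adjmx C) (adjmx B) (adjmx D).
Proof. by rewrite /adjmx map_block_mx tr_block_mx. Qed.

Lemma adjmx_row m n1 n2 (A : 'M[F]_(m, n1)) (B : 'M[F]_(m, n2)) :
  adjmx (row_mx A B) = col_mx (adjmx A) (adjmx B).
Proof. by rewrite /adjmx map_row_mx tr_row_mx. Qed.

Lemma adjmx_col m1 m2 n (A : 'M[F]_(m1, n)) (B : 'M[F]_(m2, n)) :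
  adjmx (col_mx A B) = row_mx (adjmx A) (adjmx B).
Proof. by rewrite /adjmx map_col_mx tr_col_mx. Qed.

Lemma selfadjoint_conj m n (X : 'M[F]_n) (V : 'M[F]_(n, m)) :
  selfadjoint X -> selfadjoint (adjmx V *m X *m V).
Proof. by move=> sX; rewrite /selfadjoint !adjmxM adjmxK sX mulmxA. Qed.

Lemma selfadjointB n (X Y : 'M[F]_n) :
  selfadjoint X -> selfadjoint Y -> selfadjoint (X - Y).
Proof. by rewrite /selfadjoint adjmxB => -> ->. Qed.

Lemma selfadjointD n (X Y : 'M[F]_n) :
  selfadjoint X -> selfadjoint Y -> selfadjoint (X + Y).
Proof. by rewrite /selfadjoint adjmxD => -> ->. Qed.

Lemma selfadjointN n (X : 'M[F]_n) : selfadjoint X -> selfadjoint (- X).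
Proof. by rewrite /selfadjoint adjmxN => ->. Qed.

Lemma selfadjointZ n a (X : 'M[F]_n) :
  0 <= a -> selfadjoint X -> selfadjoint (a *: X).
Proof. by move=> a0; rewrite /selfadjoint adjmxZ (RCconj_real a0) => ->. Qed.

Lemma selfadjoint_real n (X : 'M[F]_n) (v : 'cV[F]_n) :
  selfadjoint X -> (adjmx v *m X *m v) 0 0 \is Num.real.
Proof.
move=> /(selfadjoint_conj v) /matrixP /(_ 0 0) sXv.
by apply: RCreal_conj; rewrite -[RHS]sXv !mxE.
Qed.

Lemma penrose_adjmx m n (X : 'M[F]_(m, n)) (Y : 'M[F]_(n, m)) :
  penrose X Y -> penrose (adjmx X) (adjmx Y).
Proof.
case=> XYX YXY sXY sYX; split; rewrite /selfadjoint -?adjmxM.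
- by rewrite mulmxA XYX.
- by rewrite mulmxA YXY.
- by rewrite sYX.
- by rewrite sXY.
Qed.

Lemma mpinv_eq m n (X : 'M[F]_(m, n)) Y : penrose X Y -> mpinv X = Y.
Proof. exact/penrose_unique/mpinvP. Qed.

Lemma mpinvN m n (X : 'M[F]_(m, n)) : mpinv (- X) = - mpinv X.
Proof.
apply: mpinv_eq; have [XYX YXY sXY sYX] := mpinvP X.
by split; rewrite !(mulNmx, mulmxN) ?opprK ?XYX ?YXY.
Qed.

Lemma selfadjoint_mpinv n (X : 'M[F]_n) :
  selfadjoint X -> selfadjoint (mpinv X).
Proof.
by move=> sX; apply/esym/mpinv_eq; rewrite -{1}sX; exact/penrose_adjmx/mpinvP.
Qed.

Lemma mpinvC n (X : 'M[F]_n) :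
  selfadjoint X -> mpinv X *m X = X *m mpinv X.
Proof.
move=> sX; have [_ _ sXY _] := mpinvP X.
by rewrite -sXY adjmxM sX selfadjoint_mpinv.
Qed.

Lemma mulmx_mpinv_sub m n p (X : 'M[F]_(m, n)) (Y : 'M[F]_(p, n)) :
  (Y <= X)%MS -> Y *m mpinv X *m X = Y.
Proof.
by have [XYX _ _ _] := mpinvP X; case/submxP=> W ->;
  rewrite -!mulmxA (mulmxA X) XYX.
Qed.

Lemma col_mulmx_eq0 m n (X : 'M[F]_(m, n)) :
  (forall v : 'cV_n, X *m v = 0) -> X = 0.
Proof.
move=> X0; apply/matrixP => i j.
by have /matrixP/(_ i 0) := X0 (delta_mx j 0); rewrite -colE !mxE.
Qed.

(** The columns of [cokermx X] lie in the kernel of [X]. Kernel inclusions are thus traded for row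
    space inclusions, which can be compared by rank. *)
Lemma ker_submx m1 m2 n (X : 'M[F]_(m1, n)) (Y : 'M[F]_(m2, n)) :
  (forall v : 'cV_n, X *m v = 0 -> Y *m v = 0) -> (Y <= X)%MS.
Proof.
move=> kXY; rewrite submxE; apply/eqP/col_mulmx_eq0 => v.
by rewrite -mulmxA kXY // mulmxA mulmx_coker mul0mx.
Qed.

Lemma submx_ker m1 m2 n p (X : 'M[F]_(m1, n)) (Y : 'M[F]_(m2, n))
    (V : 'M[F]_(n, p)) :
  (Y <= X)%MS -> X *m V = 0 -> Y *m V = 0.
Proof. by case/submxP=> W -> XV; rewrite -mulmxA XV mulmx0. Qed.

Lemma mpinv_mulmx_sub n (X Y : 'M[F]_n) :
  selfadjoint X -> selfadjoint Y -> (Y <= X)%MS -> X *m mpinv X *m Y = Y.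
Proof.
move=> sX sY YX; rewrite -[RHS]sY -[in RHS](mulmx_mpinv_sub YX).
by rewrite !adjmxM sX sY selfadjoint_mpinv // mulmxA.
Qed.

Lemma mpinv_submx n (X : 'M[F]_n) : selfadjoint X -> (mpinv X <= X)%MS.
Proof.
move=> sX; have [_ <- _ _] := mpinvP X.
by rewrite -mulmxA -mpinvC // mulmxA submxMl.
Qed.

End Adjoint.

Lemma addmxE (V : nmodType) m n (A B : 'M[V]_(m, n)) i j :
  (A + B) i j = A i j + B i j.
Proof. by rewrite mxE. Qed.

Lemma oppmxE (V : zmodType) m n (A : 'M[V]_(m, n)) i j : (- A) i j = - A i j.
Proof. by rewrite mxE. Qed.

Lemma scalemxE (K : pzRingType) m n a (A : 'M[K]_(m, n)) i j :
  (a *: A) i j = a * A i j.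
Proof. by rewrite mxE. Qed.

(** Only sums, opposites and scalings are unfolded, whereas [mxE] would also expand products; [ring]
    then treats the entries of products as atoms. *)
Ltac mxlin :=
  apply/matrixP => ? ?; rewrite !(addmxE, oppmxE, scalemxE); ring.

(** * Positive semi-definite matrices without spectral theory *)

Section Psd.
Context {R : realType} {k : RCkind}.
Local Notation F := (RCfield R k).

Lemma gram_ge0 n (v : 'cV[F]_n) : 0 <= (adjmx v *m v) 0 0.
Proof.
rewrite mxE sumr_ge0 // => i _.
by rewrite !mxE RCconj_normK exprn_ge0.
Qed.

Lemma psdmxD n (X Y : 'M[F]_n) : psdmx X -> psdmx Y -> psdmx (X + Y).
Proof.
case=> sX X0 [sY Y0]; split=> [|v]; first exact: selfadjointD.
by rewrite mulmxDr mulmxDl addmxE addr_ge0.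
Qed.

Lemma psdmxZ n a (X : 'M[F]_n) : 0 <= a -> psdmx X -> psdmx (a *: X).
Proof.
move=> a0 [sX X0]; split=> [|v]; first exact: selfadjointZ.
by rewrite -scalemxAr -scalemxAl scalemxE mulr_ge0.
Qed.

Lemma psdmx_conj m n (X : 'M[F]_n) (V : 'M[F]_(n, m)) :
  psdmx X -> psdmx (adjmx V *m X *m V).
Proof.
case=> sX X0; split=> [|v]; first exact: selfadjoint_conj.
by have := X0 (V *m v); rewrite adjmxM !mulmxA.
Qed.

(** Each [|v_i| |v_j|] is at most [|v|^2], so the sum of the moduli of the entries bounds the form;
    the added 1 keeps [c] positive when [X = 0]. *)
Lemma selfadjoint_le_scalar n (X : 'M[F]_n) :
  selfadjoint X -> exists2 c, 0 < c & psdmx (c%:M - X).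
Proof.
move=> sX; exists (1 + \sum_j \sum_i `|X i j|).
  by rewrite ltr_wpDr // sumr_ge0 // => j _; rewrite sumr_ge0.
have c0 : 0 <= 1 + \sum_j \sum_i `|X i j|.
  by rewrite addr_ge0 // sumr_ge0 // => j _; rewrite sumr_ge0.
have sZ : selfadjoint ((1 + \sum_j \sum_i `|X i j|)%:M - X).
  apply: selfadjointB => //.
  by rewrite -scalemx1; apply: selfadjointZ => //; rewrite /selfadjoint adjmx1.
split=> // v; rewrite mulmxBr mulmxBl addmxE oppmxE -scalemx1 -scalemxAr.
rewrite -scalemxAl scalemxE mulmx1 subr_ge0.
set s := (adjmx v *m v) 0 0; have s0 : 0 <= s by exact: gram_ge0.
have vs i : `|v i 0| ^+ 2 <= s.
  rewrite /s mxE (bigD1 i) //= !mxE RCconj_normK lerDl sumr_ge0 // => j _.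
  by rewrite !mxE RCconj_normK exprn_ge0.
have vvs i j : `|v i 0| * `|v j 0| <= s.
  have h : 2 * (`|v i 0| * `|v j 0|) <= 2 * s.
    have := vs i; have := vs j; set a := `|v i 0|; set b := `|v j 0|.
    have : 0 <= (a - b) ^+ 2.
      by apply: real_exprn_even_ge0; rewrite // realB ?normr_real.
    rewrite -!(subr_ge0 _ s) -(subr_ge0 _ (2 * s)) => h1 h2 h3.
    have -> : 2 * s - 2 * (a * b) = (a - b) ^+ 2 + (s - b ^+ 2) + (s - a ^+ 2).
      by ring.
    exact: (addr_ge0 (addr_ge0 h1 h2) h3).
  by rewrite ler_pM2l in h.
apply: le_trans (real_ler_norm (selfadjoint_real v sX)) _.
have -> : (adjmx v *m X *m v) 0 0 =
    \sum_j \sum_i RCconj (v i 0) * X i j * v j 0.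
  rewrite mxE; apply: eq_bigr => j _; rewrite mxE big_distrl /=.
  by apply: eq_bigr => i _; rewrite !mxE.
rewrite mulrDl mul1r ler_wpDl // (le_trans (ler_norm_sum _ _ _)) //.
rewrite big_distrl ler_sum //= => j _; rewrite (le_trans (ler_norm_sum _ _ _)) //.
rewrite big_distrl ler_sum //= => i _; rewrite !normrM.
have -> : `|RCconj (v i 0)| = `|v i 0|.
  apply/eqP; rewrite -(@eqrXn2 _ 2) // -!RCconj_normK RCconjK.
  by rewrite mulrC.
by rewrite mulrAC [X in X <= _]mulrC ler_wpM2l.
Qed.

(** With [d = c^-1], [c X - X^2 = c ((1 - d X) X (1 - d X) + d^2 X (c - X) X)], a sum of congruences
    of positive semi-definite matrices. *)
Lemma psdmx_sqr_le n (X : 'M[F]_n) :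
  psdmx X -> exists2 c, 0 < c & psdmx (c *: X - X *m X).
Proof.
move=> pX; have [sX _] := pX; have [c c0 pc] := selfadjoint_le_scalar sX.
exists c => //; have cV0 : 0 <= c^-1 by rewrite invr_ge0 ltW.
have p1 := psdmx_conj (1%:M - c^-1 *: X) pX.
have p2 := psdmxZ (exprn_ge0 2 cV0) (psdmx_conj X pc).
have := psdmxZ (ltW c0) (psdmxD p1 p2).
rewrite adjmxB adjmxZ adjmx1 (RCconj_real cV0) sX.
rewrite -(scalemx1 _ c) !(mulmxBl, mulmxBr, mul1mx, mulmx1).
rewrite -!(scalemxAl, scalemxAr) !(mulmx1, mul1mx); congr (@psdmx R k n).
apply/matrixP => i j; rewrite !(addmxE, oppmxE, scalemxE).
set d := c^-1; set x := X i j; set y := (X *m X) i j; set z := (_ *m X) i j.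
have cd : c * d = 1 by rewrite mulfV ?gt_eqF.
have -> : c * (x - d * y - (d * y - d * (d * z)) + d ^+ 2 * (c * y - z)) =
    c * x - 2 * (c * d) * y + (c * d) ^+ 2 * y by ring.
by rewrite cd; ring.
Qed.

(** By [psdmx_sqr_le], [|X v|^2 <= c v^* X v]. *)
Lemma psdmx_ker n (X : 'M[F]_n) (v : 'cV[F]_n) :
  psdmx X -> (adjmx v *m X *m v) 0 0 = 0 -> X *m v = 0.
Proof.
move=> pX vXv; have [sX _] := pX; have [c c0 [_ /(_ v)]] := psdmx_sqr_le pX.
rewrite mulmxBr mulmxBl -scalemxAr -scalemxAl addmxE oppmxE scalemxE vXv.
rewrite mulr0 sub0r oppr_ge0 => le0; apply: adjmx_mul_eq0.
rewrite adjmxM sX mulmxA -[adjmx v *m X *m X]mulmxA.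
apply/matrixP => i j; rewrite !ord1 [RHS]mxE; apply/eqP; rewrite eq_le le0 /=.
have := gram_ge0 (X *m v); by rewrite adjmxM sX !mulmxA.
Qed.

End Psd.

(** * Positivity and rank along affine pencils *)

Section Pencils.
Context {R : realType} {k : RCkind}.
Local Notation F := (RCfield R k).

(** Induction on [t]: a negative value of the form at [s] persists just before [s]; and if
    [Z = X + s Y] is positive semi-definite, the row space inclusion bounds [Y] below by a multiple
    of [- Z], so positivity continues past [s]. *)
Lemma psdmx_pencil n (X Y : 'M[F]_n) :
  psdmx X -> selfadjoint Y ->
  (forall t : F, 0 <= t <= 1 -> (Y <= (X + t *: Y)%R)%MS) -> psdmx (X + Y).
Proof.
move=> pX sY YX; have [sX _] := pX.
have sP (t : F) : 0 <= t -> selfadjoint (X + t *: Y).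
  by move=> t0; apply: selfadjointD => //; exact: selfadjointZ.
rewrite -[Y in _ + Y]scale1r.
apply: (@RC_unit_interval_ind _ _ (fun t : F => psdmx (X + t *: Y))).
  by rewrite scale0r addr0.
move=> s s01; have /andP[s0 s1] := s01.
have [[_ pXs]|nXs] := pselect (psdmx (X + s *: Y)); last first.
  have [v /negP qv] : exists v : 'cV_n, ~ 0 <= (adjmx v *m (X + s *: Y) *m v) 0 0.
    by apply/existsNP => pXs; apply: nXs; split=> //; exact: sP.
  have qr := selfadjoint_real v (sP s s0); have yr := selfadjoint_real v sY.
  have q0 : (adjmx v *m (X + s *: Y) *m v) 0 0 < 0 by rewrite real_ltNge.
  set q := (_ *m v) 0 0 in q0 qr qv; set y := (_ *m v) 0 0 in yr.
  have ny0 : 0 < `|y| + 1 by rewrite ltr_wpDl.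
  (* Moving back from [s] by less than this changes the form at [v] by less than [- q], so it stays
     negative and the induction step is vacuous. *)
  exists (- q / (`|y| + 1)) => [|t u /andP[t0 ts] _ st _ [_ /(_ v)] pt].
    by rewrite divr_gt0 // oppr_gt0.
  exfalso; move: pt; apply/negP.
  have -> : X + t *: Y = (X + s *: Y) - (s - t) *: Y.
    by rewrite scalerBl opprB addrA addrAC addrK.
  rewrite mulmxBr mulmxBl -scalemxAr -scalemxAl addmxE oppmxE scalemxE -/q -/y.
  have str : (s - t) * y \is Num.real.
    by apply: realM => //; rewrite ger0_real // subr_ge0.
  rewrite subr_ge0 -real_ltNge //.
  rewrite ltr_pdivlMr // in st.
  have h1 : - ((s - t) * y) <= (s - t) * `|y|.
    rewrite -mulrN ler_wpM2l ?subr_ge0 // -normrN.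
    by rewrite real_ler_norm // realN.
  have h2 : (s - t) * `|y| <= (s - t) * (`|y| + 1).
    by rewrite ler_wpM2l ?subr_ge0 // lerDl.
  by rewrite -ltrN2 (le_lt_trans h1) // (le_lt_trans h2).
set Z := X + s *: Y in pXs *.
have sZ : selfadjoint Z by exact: sP.
have pZ : psdmx Z by [].
have YsubZ : (Y <= Z)%MS by exact: YX.
have ZE : Z = X + s *: Y by [].
clearbody Z.
have [c c0 pc] := psdmx_sqr_le pZ.
have sG := selfadjoint_mpinv sZ.
have sW : selfadjoint (- (mpinv Z *m Y *m mpinv Z)).
  by apply: selfadjointN; rewrite -{1}sG; exact: selfadjoint_conj.
(* Conjugating [d + Z^+ Y Z^+] by [Z] yields [d Z^2 + Y], because [Y = Z Z^+ Y Z^+ Z]; then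
   [Z^2 <= c Z] replaces the square. *)
have [d d0 /(psdmx_conj Z)] := selfadjoint_le_scalar sW.
have YZ : Y *m mpinv Z *m Z = Y by exact: mulmx_mpinv_sub.
have ZY : Z *m mpinv Z *m Y = Y by exact: mpinv_mulmx_sub.
rewrite sZ opprK mulmxDr mulmxDl !mulmxA ZY YZ mul_mx_scalar -scalemxAl => pd.
have pcd : psdmx ((d * c) *: Z + Y).
  have := psdmxD (psdmxZ (ltW d0) pc) pd.
  by rewrite scalerBr scalerA addrA subrK.
have dc0 : 0 < d * c by rewrite mulr_gt0.
exists (d * c)^-1 => [|t u _ /andP[su _] _ use _]; first by rewrite invr_gt0.
have -> : X + u *: Y =
    (u - s) *: ((d * c) *: Z + Y) + (1 - (u - s) * (d * c)) *: Z.
  by rewrite ZE; mxlin.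
apply: psdmxD; apply: psdmxZ => //; first by rewrite subr_ge0.
by rewrite subr_ge0 -ler_pdivlMr // mul1r ltW.
Qed.

(* [1 + s N] is singular only when [- s^-1] is one of the finitely many
   eigenvalues of [N]. *)
Lemma unitmx_perturb n (N : 'M[F]_n) :
  exists m : nat, 1%:M + m.+1%:R^-1 *: N \in unitmx.
Proof.
apply: contrapT => /forallNP nU.
pose rs : seq F := [seq - i.+1%:R | i <- iota 0 n.+1].
suff /(max_poly_roots (monic_neq0 (char_poly_monic N))) :
    all (root (char_poly N)) rs.
  move=> roots; suff /roots : uniq rs.
    by rewrite size_char_poly size_map size_iota ltnn.
  rewrite map_inj_uniq ?iota_uniq // => i j /oppr_inj /eqP.
  by rewrite eqr_nat => /eqP[].
apply/allP => _ /mapP[i _ ->]; rewrite -eigenvalue_root_char.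
have /negP := nU i; rewrite -row_free_unit -kermx_eq0.
have i0 : (i.+1%:R : F) != 0 by rewrite pnatr_eq0.
apply: contraNT => /negPn; rewrite /eigenvalue /eigenspace => /eqP K0.
rewrite kermx_eq0 row_free_unit.
have -> : 1%:M + i.+1%:R^-1 *: N = i.+1%:R^-1 *: (N - (- i.+1%:R)%:M).
  by rewrite raddfN opprK scalerDr addrC scale_scalar_mx mulVf.
by rewrite unitmxZ ?unitfE ?invr_eq0 // -row_free_unit -kermx_eq0 K0.
Qed.

(** One-sided inverses of a full rank factorization compress [M] to an identity of size [\rank M],
    which some small perturbation leaves invertible. *)
Lemma rank_perturb n (M N : 'M[F]_n) :
  exists m : nat, (\rank M <= \rank (M + m.+1%:R^-1 *: N)%R)%N.
Proof.
set L := pinvmx (col_base M); set K := pinvmx (row_base M).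
have LMK : L *m M *m K = 1%:M.
  have := mulmxVp (row_base_free M); rewrite -{1}(mul1mx (row_base M)).
  by rewrite -(mulVpmx (col_base_full M)) -[_ *m row_base M]mulmxA mulmx_base.
have [m /mxrank_unit rkm] := unitmx_perturb (L *m N *m K); exists m.
rewrite -[X in (X <= _)%N]rkm -LMK scalemxAl scalemxAr -mulmxDl -mulmxDr.
exact: leq_trans (mxrankM_maxl _ _) (mxrankM_maxr _ _).
Qed.
End Pencils.

(** * Row spaces and resolvent identities for two self-adjoint matrices *)

Section Monotone.
Context {R : realType} {k : RCkind}.
Local Notation F := (RCfield R k).

Lemma sqr_ker n (X : 'M[F]_n) (v : 'cV[F]_n) :
  selfadjoint X -> X *m (X *m v) = 0 -> X *m v = 0.
Proof.
move=> sX XXv; apply: adjmx_mul_eq0.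
by rewrite adjmxM sX -mulmxA XXv mulmx0.
Qed.

(** Let [P = X^+ X]. The matrix [M = X + (1 - P) Y] vanishes only on the common kernel of [X] and
    [Y], and [(P + s^-1 (1 - P)) (X + s Y) = M + s P Y] has rank at most [r = \rank X]. For a
    suitable [s] this bounds [\rank M]. *)
Lemma rank_pencil_submx n (X Y : 'M[F]_n) (r : nat) :
  selfadjoint X -> psdmx Y ->
  (forall t : F, 0 <= t <= 1 -> \rank (X + t *: Y)%R = r) -> (Y <= X)%MS.
Proof.
move=> sX pY rk; set G := mpinv X.
have [XGX _ sXG _] := mpinvP X; have GX : G *m X = X *m G by exact: mpinvC.
pose M := X + (1%:M - G *m X) *m Y.
have kM (v : 'cV_n) : M *m v = 0 -> X *m v = 0 /\ Y *m v = 0.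
  move=> Mv; have Xv : X *m v = 0.
    apply: sqr_ker => //; rewrite mulmxA -[RHS](mulmx0 _ X) -Mv mulmxA.
    congr (_ *m v); rewrite /M mulmxDr mulmxA mulmxBr mulmx1 mulmxA XGX.
    by rewrite subrr mul0mx addr0.
  split=> //; apply: psdmx_ker => //; move: Mv.
  rewrite /M [(X + _) *m v]mulmxDl Xv add0r mulmxBl mul1mx mulmxBl => /eqP.
  rewrite subr_eq0 => /eqP YE; rewrite -mulmxA YE GX !mulmxA.
  by rewrite -{1}sX -adjmxM Xv adjmx0 !mul0mx mxE.
have XM : (X <= M)%MS by apply: ker_submx => v /kM[].
have YM : (Y <= M)%MS by apply: ker_submx => v /kM[].
(* Given [X <= M], the inclusion [M <= X] amounts to [\rank M <= \rank X]. *)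
apply: submx_trans YM _; rewrite -(geq_leqif (mxrank_leqif_sup XM)).
have [m] := rank_perturb M (G *m X *m Y); set s := m.+1%:R^-1.
move=> /leq_trans; apply.
have s1 : 0 <= s <= 1.
  by rewrite invr_ge0 ler0n invf_le1 ?ltr0n // ler1n.
have s0 : s != 0 by rewrite invr_eq0 pnatr_eq0.
have -> : M + s *: (G *m X *m Y) =
    (G *m X + s^-1 *: (1%:M - G *m X)) *m (X + s *: Y).
  rewrite mulmxDl !mulmxDr -!scalemxAr -!scalemxAl scalerA mulfV // scale1r.
  rewrite [(1%:M - _) *m X]mulmxBl mul1mx GX XGX subrr scaler0 add0r /M GX.
  by rewrite addrAC.
apply: (leq_trans (mxrankM_maxr _ _)); rewrite (rk s s1) -(rk 0) ?lexx ?ler01 //.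
by rewrite scale0r addr0.
Qed.

Variables (n : nat) (X Y : 'M[F]_n).
Hypotheses (sX : selfadjoint X) (sY : selfadjoint Y).

(* On the image of [v |-> (v - Y v, Y v + Y^2 v)] the form
   [a^* Y a - b^* Y^+ b] is [-4 |Y v|^2], while it dominates
   [a^* X a - b^* X^+ b], which vanishes when [X a - b] lies in [ker X].
   Hence [ker (X W)], with [W v = X a - b], lies in [ker X] and in [ker Y],
   and the inclusion of row spaces follows by comparing ranks. *)
Lemma loewner_mpinv_submx :
  loewner X Y -> loewner (mpinv Y) (mpinv X) -> (Y <= X)%MS.
Proof.
move=> [_ XY] [_ GYX].
have sGX := selfadjoint_mpinv sX; have sGY := selfadjoint_mpinv sY.
pose W := X *m (1%:M - Y) - Y *m (1%:M + Y).
have kW (v : 'cV_n) : X *m W *m v = 0 -> X *m v = 0 /\ Y *m v = 0.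
  rewrite -mulmxA; set z := W *m v => Xz.
  have [a aE] : exists a, a = v - Y *m v by eexists.
  have [c cE] : exists c, c = v + Y *m v by eexists.
  pose b := Y *m c.
  have bE : b = X *m a - z.
    rewrite /z /W mulmxBl -!mulmxA /b cE aE mulmxBl mulmxDl !mul1mx.
    by rewrite subKr.
  have Gz : mpinv X *m z = 0 by apply: submx_ker Xz; exact: mpinv_submx.
  have zG : adjmx z *m mpinv X = 0 by rewrite -sGX -adjmxM Gz adjmx0.
  have bXb : adjmx b *m mpinv X *m b = adjmx a *m X *m a.
    rewrite bE adjmxB adjmxM sX mulmxBl zG subr0 mulmxBr -[_ *m z]mulmxA Gz.
    rewrite mulmx0 subr0 !mulmxA -!(mulmxA (adjmx a)).
    by have [-> _ _ _] := mpinvP X.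
  have bYb : adjmx b *m mpinv Y *m b = adjmx c *m Y *m c.
    rewrite adjmxM sY !mulmxA -!(mulmxA (adjmx c)).
    by have [-> _ _ _] := mpinvP Y.
  have : 0 <= - 4 * (adjmx (Y *m v) *m (Y *m v)) 0 0.
    have := addr_ge0 (XY a) (GYX b).
    rewrite !mulmxBr !mulmxBl -!addmxE bXb bYb addrA subrK.
    have -> : adjmx a *m Y *m a - adjmx c *m Y *m c =
        - 4 *: (adjmx (Y *m v) *m (Y *m v)).
      rewrite cE aE adjmxB adjmxD adjmxM sY.
      rewrite !(mulmxDl, mulmxDr, mulNmx, mulmxN) !mulmxA.
      by mxlin.
    by rewrite scalemxE.
  rewrite nmulr_rge0 ?oppr_lt0 // => le0.
  have Yv : Y *m v = 0.
    apply: adjmx_mul_eq0; apply/matrixP => i j; rewrite !ord1 [RHS]mxE.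
    by apply/eqP; rewrite eq_le le0 gram_ge0.
  split=> //; apply: sqr_ker => //; move: Xz.
  by rewrite /z /W mulmxBl -!mulmxA mulmxBl mulmxDl !mul1mx Yv subr0
    addr0 Yv subr0.
have XXW : (X <= X *m W)%MS by apply: ker_submx => v /kW[].
have YXW : (Y <= X *m W)%MS by apply: ker_submx => v /kW[].
apply: submx_trans YXW _.
by rewrite -(geq_leqif (mxrank_leqif_sup XXW)) mxrankM_maxl.
Qed.

(** On the kernel of the pencil [X v = - t w] and [Y v = (1 - t) w], so [h = v^* E v] equals both
    [- t w^* X^+ w] and [(1 - t) w^* Y^+ w]. Combining the two gives [- h >= 0]. *)
Lemma loewner_mpinv_pencil_submx (t : F) :
  loewner X Y -> loewner (mpinv Y) (mpinv X) -> (Y <= X)%MS -> (X <= Y)%MS ->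
  0 <= t <= 1 -> (X <= (X + t *: (Y - X))%R)%MS.
Proof.
move=> pE [_ pG] YX XY /andP[t0 t1]; have [sE E0] := pE.
set E := Y - X in pE sE E0 *.
have EX : (E <= X)%MS by rewrite addmx_sub // eqmx_opp.
have EY : (E <= Y)%MS by rewrite addmx_sub // eqmx_opp.
apply: ker_submx => v; rewrite mulmxDl -scalemxAl => /eqP.
rewrite addr_eq0 => /eqP Xv; set w := E *m v in Xv.
have Yv : Y *m v = (1 - t) *: w.
  by rewrite -[Y](subrK X) mulmxDl Xv -/E -/w; mxlin.
set h := (adjmx v *m E *m v) 0 0.
have hX : - t * (adjmx w *m mpinv X *m w) 0 0 = h.
  rewrite -scalemxE scaleNr scalemxAr -mulmxN -Xv adjmxM sE.
  by rewrite !mulmxA -!(mulmxA (adjmx v)) mulmx_mpinv_sub // mulmxA.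
have hY : (1 - t) * (adjmx w *m mpinv Y *m w) 0 0 = h.
  rewrite -scalemxE scalemxAr -Yv adjmxM sE.
  by rewrite !mulmxA -!(mulmxA (adjmx v)) mulmx_mpinv_sub // mulmxA.
have h0 : h = 0.
  apply/eqP; rewrite eq_le E0 andbT.
  have := pG w; rewrite mulmxBr mulmxBl addmxE oppmxE.
  set p := (_ *m w) 0 0 in hX *; set q := (_ *m w) 0 0 in hY * => pq.
  have : 0 <= t * (1 - t) * (p - q).
    by apply: mulr_ge0 pq; rewrite mulr_ge0 // subr_ge0.
  have -> : t * (1 - t) * (p - q) = - ((1 - t) * (- t * p)) - t * ((1 - t) * q).
    by ring.
  rewrite hX hY.
  have -> : - ((1 - t) * h) - t * h = - h by ring.
  by rewrite oppr_ge0.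
by rewrite Xv /w (psdmx_ker pE h0) scaler0 oppr0.
Qed.

(** Equal row spaces give [X] and [Y] the same range projector, so the resolvent identities survive
    for pseudoinverses. Substituting the second into the first gives the congruence. *)
Lemma mpinvB_factor :
  (Y <= X)%MS -> (X <= Y)%MS ->
  [/\ mpinv X - mpinv Y = mpinv Y *m (Y - X) *m mpinv X,
      mpinv X - mpinv Y = mpinv X *m (Y - X) *m mpinv Y &
      mpinv X - mpinv Y =
      mpinv Y *m ((Y - X) + (Y - X) *m mpinv X *m (Y - X)) *m mpinv Y].
Proof.
move=> YX XY; have sGX := selfadjoint_mpinv sX; have sGY := selfadjoint_mpinv sY.
have GXY := submx_trans (mpinv_submx sX) XY.
have GYX := submx_trans (mpinv_submx sY) YX.
have E1 : mpinv X - mpinv Y = mpinv Y *m (Y - X) *m mpinv X.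
  rewrite mulmxBr mulmxBl (mpinvC sY) mpinv_mulmx_sub //.
  by rewrite -(mulmxA _ X) -(mpinvC sX) mulmxA mulmx_mpinv_sub.
have E2 : mpinv X - mpinv Y = mpinv X *m (Y - X) *m mpinv Y.
  rewrite mulmxBr mulmxBl (mpinvC sX) mpinv_mulmx_sub //.
  by rewrite -(mulmxA _ Y) -(mpinvC sY) mulmxA mulmx_mpinv_sub.
split=> //; move: E1 E2; move: (Y - X) => E E1 E2.
rewrite -mulmxA mulmxDl -!mulmxA (mulmxA (mpinv X)) -E2.
by rewrite mulmxBr [X in _ = _ *m X]addrC subrK mulmxA.
Qed.

(** The pencil from [E] to [E + E X^+ E] satisfies [psdmx_pencil]: with [u = X^+ E v] one has
    [X u = E v] and [(E + t E X^+ E) v = (X + t E) u]. Constant rank gives [X + t E] the kernel of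
    [X], so if this vanishes then [E v = X u = 0]. *)
Lemma rank_pencil_psdmx (r : nat) :
  psdmx (Y - X) ->
  (forall t : F, 0 <= t <= 1 -> \rank (X + t *: (Y - X))%R = r) ->
  psdmx ((Y - X) + (Y - X) *m mpinv X *m (Y - X)).
Proof.
move=> pE rk; have [sE _] := pE; have EX := rank_pencil_submx sX pE rk.
move: pE sE EX rk; move: (Y - X) => E pE sE EX rk.
apply: psdmx_pencil => //.
  by rewrite -{1}sE; apply/selfadjoint_conj/selfadjoint_mpinv.
move=> t t01; apply: ker_submx => v.
have XGE : X *m (mpinv X *m (E *m v)) = E *m v.
  by rewrite !mulmxA mpinv_mulmx_sub.
rewrite mulmxDl -scalemxAl -!mulmxA => Ev0.
suff -> : E *m v = 0 by rewrite !mulmx0.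
have XtX : ((X + t *: E)%R <= X)%MS by rewrite addmx_sub ?scalemx_sub.
have XXt : (X <= (X + t *: E)%R)%MS.
  rewrite -(geq_leqif (mxrank_leqif_sup XtX)) (rk t t01).
  by rewrite -(rk 0) ?lexx ?ler01 // scale0r addr0.
rewrite -XGE; apply: (submx_ker XXt).
by rewrite mulmxDl XGE -scalemxAl.
Qed.

End Monotone.

(** * Order reversal of pseudoinverses versus constant rank *)

Section Reversal.
Context {R : realType} {k : RCkind}.
Local Notation F := (RCfield R k).
Variables (n : nat) (X Y : 'M[F]_n).
Hypotheses (sX : selfadjoint X) (sY : selfadjoint Y) (XY : loewner X Y).

Lemma loewner_mpinv_submx2 :
  loewner (mpinv Y) (mpinv X) -> (Y <= X)%MS /\ (X <= Y)%MS.
Proof.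
move=> GYX; split; first exact: loewner_mpinv_submx.
(* The pair [- Y], [- X] satisfies the same two inequalities. *)
have : (- X <= - Y)%MS.
  apply: loewner_mpinv_submx; rewrite ?mpinvN /loewner ?opprK;
    try exact: selfadjointN; by rewrite addrC.
by rewrite !eqmx_opp.
Qed.

Lemma loewner_mpinv_rank :
  loewner (mpinv Y) (mpinv X) ->
  forall t : F, 0 <= t <= 1 -> \rank (X + t *: (Y - X))%R = \rank X.
Proof.
move=> GYX t t01; have [YX XsubY] := loewner_mpinv_submx2 GYX.
apply/eqP; rewrite eqn_leq !mxrankS //.
  exact: loewner_mpinv_pencil_submx.
by rewrite addmx_sub ?scalemx_sub ?addmx_sub ?eqmx_opp.
Qed.

Lemma rank_pencil_loewner_mpinv (r : nat) :
  (forall t : F, 0 <= t <= 1 -> \rank (X + t *: (Y - X))%R = r) ->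
  loewner (mpinv Y) (mpinv X).
Proof.
move=> rk; have EX := rank_pencil_submx sX XY rk.
have YX : (Y <= X)%MS by rewrite -[Y](subrK X) addmx_sub.
have XsubY : (X <= Y)%MS.
  rewrite -(geq_leqif (mxrank_leqif_sup YX)).
  (* The endpoints of the pencil give [\rank Y = \rank X]. *)
  have := rk 1; rewrite scale1r addrC subrK lexx ler01 => -> //.
  by have := rk 0; rewrite scale0r addr0 lexx ler01 => -> .
have [_ _] := mpinvB_factor sX sY YX XsubY; rewrite /loewner => ->.
rewrite -{1}(selfadjoint_mpinv sY); apply: psdmx_conj.
exact: rank_pencil_psdmx rk.
Qed.

End Reversal.

(** * Block matrices and Schur complements *)

Section BlockPsd.
Context {R : realType} {k : RCkind}.
Local Notation F := (RCfield R k).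
Variables n1 n2 : nat.

Section Blocks.
Variables (P : 'M[F]_n1) (Q : 'M[F]_(n1, n2)) (Q' : 'M[F]_(n2, n1)).
Variable S : 'M[F]_n2.

Lemma selfadjoint_block :
  selfadjoint (block_mx P Q Q' S) <->
  [/\ selfadjoint P, adjmx Q = Q' & selfadjoint S].
Proof.
rewrite /selfadjoint adjmx_block; split=> [/eq_block_mx[-> _ -> ->] //|].
by case=> -> <- ->; rewrite adjmxK.
Qed.

Hypothesis pM : psdmx (block_mx P Q Q' S).

Lemma psdmx_ul : psdmx P.
Proof.
have := psdmx_conj (col_mx 1%:M 0) pM.
rewrite adjmx_col adjmx1 adjmx0 mul_row_block mul_row_col.
by rewrite !(mul1mx, mul0mx, mulmx1, mulmx0, addr0).
Qed.

Lemma psdmx_dr : psdmx S.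
Proof.
have := psdmx_conj (col_mx 0 1%:M) pM.
rewrite adjmx_col adjmx1 adjmx0 mul_row_block mul_row_col.
by rewrite !(mul1mx, mul0mx, mulmx1, mulmx0, add0r).
Qed.

(** If [S v = 0], the form vanishes at [(0, v)], so the whole matrix kills that vector. *)
Lemma psdmx_block_submx : (Q <= S)%MS.
Proof.
apply: ker_submx => v Sv; have : block_mx P Q Q' S *m col_mx 0 v = 0.
  apply: psdmx_ker => //; rewrite adjmx_col adjmx0 mul_row_block mul_row_col.
  by rewrite !(mul0mx, mulmx0, add0r) -mulmxA Sv mulmx0 mxE.
rewrite mul_block_col !mulmx0 !add0r => /eqP.
by rewrite col_mx_eq0 => /andP[/eqP].
Qed.

(** Congruence by the row [(1, - L)] with [L = Q S^+], where [L S = Q]. The Schur complement is kept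
    as [P - L S L^*] to match [ppt_identity]. *)
Lemma psdmx_block_schur :
  psdmx (P - Q *m mpinv S *m S *m adjmx (Q *m mpinv S)).
Proof.
have [_ aQ sS] := selfadjoint_block.1 pM.1.
have QS := mulmx_mpinv_sub psdmx_block_submx.
have := psdmx_conj (adjmx (row_mx 1%:M (- (Q *m mpinv S)))) pM.
rewrite adjmxK adjmx_row adjmx1 adjmxN mul_row_block mul_row_col.
rewrite !mul1mx !mulmx1 !mulNmx QS subrr mul0mx addr0 adjmxM.
by rewrite (selfadjoint_mpinv sS) aQ mulmxA.
Qed.

End Blocks.

Lemma signmx_ppt (A : 'M[F]_(n1 + n2)) :
  signmx *m ppt A =
  block_mx (schur_compl A) (ursubmx A *m mpinv (drsubmx A))
           (mpinv (drsubmx A) *m dlsubmx A) (- mpinv (drsubmx A)).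
Proof.
rewrite mulmx_block !(mul1mx, mul0mx, addr0, add0r) !mulNmx !mul1mx.
by rewrite opprK.
Qed.

End BlockPsd.

(** Pure ring algebra, with independent letters for the adjoints. The resolvent identities give
    [G1 X = G0 E] and [X G1 = E G0], which remove [X] from every product except [L X L']. *)
Lemma ppt_identity (K : comNzRingType) n1 n2 (A12 B12 L : 'M[K]_(n1, n2))
    (A21 B21 L' : 'M[K]_(n2, n1)) (E G0 G1 X : 'M[K]_n2) :
  A12 = B12 - L *m E -> A21 = B21 - E *m L' ->
  X = E + E *m G0 *m E ->
  G0 - G1 = G1 *m E *m G0 -> G0 - G1 = G0 *m E *m G1 ->
  block_mx (L *m E *m L' - B12 *m G1 *m B21 + A12 *m G0 *m A21)
           (B12 *m G1 - A12 *m G0)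
           (G1 *m B21 - G0 *m A21) (G0 - G1) =
  col_mx (B12 *m G1 - L) (- G1) *m X *m row_mx (G1 *m B21 - L') (- G1).
Proof.
move=> -> -> XE h1 h2.
have XG m (V : 'M_(m, n2)) : V *m X *m G1 = V *m E *m G0.
  rewrite XE -mulmxA mulmxDl -!mulmxA (mulmxA G0) -h2 mulmxBr addrC.
  by rewrite subrK.
have GX m (V : 'M_(m, n2)) : V *m G1 *m X = V *m G0 *m E.
  rewrite XE -mulmxA mulmxDr !mulmxA -h1.
  by rewrite mulmxBl addrC subrK mulmxA.
have GEG m (V : 'M_(m, n2)) : V *m G0 *m E *m G1 = V *m G0 - V *m G1.
  by rewrite -mulmxBr h2 !mulmxA.
have GX1 : G1 *m X = G0 *m E by rewrite -[G1]mul1mx GX mul1mx.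
rewrite mul_col_mx mul_col_row; congr block_mx.
- rewrite !(mulmxBl, mulmxBr, mulmxA) !GX !XG GEG XE !mulmxDr !mulmxDl.
  by rewrite !(mulmxA, mulNmx); mxlin.
- rewrite !(mulmxN, mulmxBl, mulmxBr, mulmxA) GX GEG XG; mxlin.
- rewrite !(mulNmx, mulmxBl, mulmxBr, mulmxA) GX1 -h2 !mulmxBl.
  mxlin.
- by rewrite mulmxN !mulNmx opprK GX1 h2.
Qed.

(** * The difference of the signed pivot transforms *)

Section Main.
Context {R : realType} {k : RCkind}.
Local Notation F := (RCfield R k).
Variables n1 n2 : nat.

Lemma signmx_pptB (A B : 'M[F]_(n1 + n2)) :
  signmx *m ppt B - signmx *m ppt A =
  block_mx (schur_compl B - schur_compl A)
    (ursubmx B *m mpinv (drsubmx B) - ursubmx A *m mpinv (drsubmx A))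
    (mpinv (drsubmx B) *m dlsubmx B - mpinv (drsubmx A) *m dlsubmx A)
    (mpinv (drsubmx A) - mpinv (drsubmx B)).
Proof.
rewrite !signmx_ppt opp_block_mx add_block_mx opprK.
by rewrite [- mpinv (drsubmx B) + _]addrC.
Qed.

Lemma psdmx_signmx_pptB (A B : 'M[F]_(n1 + n2)) (E := drsubmx B - drsubmx A) :
  selfadjoint A -> selfadjoint B -> loewner A B ->
  (drsubmx B <= drsubmx A)%MS -> (drsubmx A <= drsubmx B)%MS ->
  psdmx (E + E *m mpinv (drsubmx A) *m E) ->
  loewner (signmx *m ppt A) (signmx *m ppt B).
Proof.
rewrite /loewner signmx_pptB /schur_compl /E {E} => sA sB.
rewrite -(submxK A) in sA; rewrite -(submxK B) in sB.
rewrite -[B in B - A]submxK -[A in _ - A]submxK opp_block_mx add_block_mx.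
move: sA sB.
move: (ulsubmx A) (ursubmx A) (dlsubmx A) (drsubmx A) => A11 A12 A21 A22.
move: (ulsubmx B) (ursubmx B) (dlsubmx B) (drsubmx B) => B11 B12 B21 B22.
move=> /selfadjoint_block[_ aA sA] /selfadjoint_block[_ aB sB] pM BA AB.
(* This gives [L E = B12 - A12] for the [L] chosen below. *)
have QS := mulmx_mpinv_sub (psdmx_block_submx pM).
have := psdmx_block_schur pM; move: QS.
have [h1 h2 _] := mpinvB_factor sA sB BA AB; move: h1 h2.
have [sE _] := psdmx_dr pM; move: sE.
move: (B22 - A22) => E sE.
set G0 := mpinv A22; have sG1 := selfadjoint_mpinv sB; move: sG1.
set G1 := mpinv B22; move=> sG1 h1 h2.
set L := (B12 - A12) *m mpinv E => LE pS pX.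
set X := E + _ in pX.
have A12E : A12 = B12 - L *m E by rewrite LE subKr.
have A21E : A21 = B21 - E *m adjmx L.
  by rewrite -aA -aB [in LHS]A12E adjmxB adjmxM sE.
have pV := psdmx_conj (row_mx (G1 *m B21 - adjmx L) (- G1)) pX.
have pU := psdmx_conj (row_mx 1%:M (0 : 'M_(n1, n2))) pS.
move: pV pU; rewrite !adjmx_row adjmxB adjmxN adjmxM adjmxK adjmx1 adjmx0 sG1.
rewrite -{1}aB adjmxK -(ppt_identity A12E A21E (erefl X) h1 h2).
rewrite mul_col_mx mul_col_row !(mul1mx, mul0mx, mulmx1, mulmx0) => pV pU.
(* In the upper left block the two copies of [L E L^*] cancel, leaving the difference of the Schur
   complements. *)
have := psdmxD pV pU; rewrite add_block_mx !addr0.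
congr (@psdmx R k _ (block_mx _ _ _ _)).
by mxlin.
Qed.

End Main.

Theorem theorem1 (R : realType) (k : RCkind) (n1 n2 : nat)
    (A B : 'M[RCfield R k]_(n1 + n2))
    (hA : selfadjoint A) (hB : selfadjoint B) (hAB : loewner A B) :
  let a := loewner (signmx *m ppt A) (signmx *m ppt B) in
  let b := loewner (mpinv (drsubmx B)) (mpinv (drsubmx A)) in
  let c := exists r : nat, forall t : RCfield R k, 0 <= t <= 1 ->
    \rank ((1 - t) *: drsubmx A + t *: drsubmx B)%R = r in
  [/\ a <-> b, b <-> c &
      (a \/ b \/ c) -> loewner (schur_compl A) (schur_compl B)].
Proof.
move=> a b c.
have sA : selfadjoint (drsubmx A).
  by move: (hA); rewrite -{1}(submxK A) => /selfadjoint_block[].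
have sB : selfadjoint (drsubmx B).
  by move: (hB); rewrite -{1}(submxK B) => /selfadjoint_block[].
have leD : loewner (drsubmx A) (drsubmx B).
  move: (hAB); rewrite /loewner -{1}(submxK A) -{1}(submxK B).
  by rewrite opp_block_mx add_block_mx => /psdmx_dr.
have pencilE (t : RCfield R k) : (1 - t) *: drsubmx A + t *: drsubmx B =
    drsubmx A + t *: (drsubmx B - drsubmx A) by mxlin.
have cb : c -> b.
  move=> [r rk]; apply: (rank_pencil_loewner_mpinv sA sB leD (r := r)) => t t01.
  by rewrite -pencilE rk.
have bc : b -> c.
  move=> hb; exists (\rank (drsubmx A)) => t t01; rewrite pencilE.
  exact: loewner_mpinv_rank.
have ab : a -> b by rewrite /a /loewner signmx_pptB => /psdmx_dr.
have ba : b -> a.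
  (* (b) supplies the equal row spaces directly and the positivity of [E + E X^+ E] through the
     constant rank. *)
  move=> hb; have [BA AB] := loewner_mpinv_submx2 sA sB leD hb.
  apply: psdmx_signmx_pptB => //; apply: rank_pencil_psdmx => //.
  exact: loewner_mpinv_rank.
have as_ : a -> loewner (schur_compl A) (schur_compl B).
  by rewrite /a /loewner signmx_pptB => /psdmx_ul.
by split=> //; case=> [/as_|[/ba/as_|/cb/ba/as_]].
Qed.
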